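(* Let $k\in\mathbb{R}$, let $(X,d)$ be a complete $\mathrm{CAT}(k)$ space, and let $P$ be a subset of $X$ with diameter less than $D_k/4$. Let $u:P\to\mathbb{R}$ be a bounded non-negative function, not identically $0$ (no continuity of $u$ is assumed). Then there is a unique point $q_u\in X$ such that $$\sup\{u(p)\,d(q_u,p)\mid p\in P\}=\inf_{x\in X}\ \sup\{u(p)\,d(x,p)\mid p\in P\}.$$
   Context: For $k>0$ put $D_k=\pi/\sqrt{k}$; for $k\le 0$ put $D_k=\infty$ (so in that case ''diameter less than $D_k/4$'' means that the diameter is finite). $M_k^2$ is the model surface of constant curvature $k$: the unit sphere $S^2$ with its angular metric divided by $\sqrt{k}$ if $k>0$, the Euclidean plane if $k=0$, the hyperbolic plane with its metric divided by $\sqrt{-k}$ if $k<0$. A geodesic metric space is a metric space in which any two points $x,y$ are joined by a geodesic segment, i.e. the image of an isometric embedding of $[0,d(x,y)]$ with endpoints $x$ and $y$. A geodesic metric space $X$ is a $\mathrm{CAT}(k)$ space if every geodesic triangle $\triangle(x,y,z)$ in $X$ of perimeter less than $2D_k$ has a comparison triangle in $M_k^2$ (a geodesic triangle with the same side lengths) such that for any two points $x',y'$ of the triangle and their comparison points $\bar x',\bar y'$ one has $d(x',y')\le d(\bar x',\bar y')$. *)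

(* Defs.v *)
From HB Require Import structures.
From mathcomp Require Import all_boot all_order all_algebra.
From mathcomp Require Import all_classical all_reals all_analysis.

Set Implicit Arguments.
Unset Strict Implicit.
Unset Printing Implicit Defensive.

Import Order.TTheory GRing.Theory Num.Theory.

Local Open Scope classical_set_scope.
Local Open Scope ring_scope.

#[short(type="completeMetricType")]
HB.structure Definition CompleteMetric (R : numDomainType) :=
  { T of Complete T & Metric R T }.

(* The notions below take a bare distance function, so that they apply both to
   metric spaces and to the explicitly given model surfaces. *)
Section Geodesics.
Context {R : realType} {T : Type} (d : T -> T -> R).

(* [c : R -> T] matters only on [0, d x y]. *)
Definition geodesic_path (x y : T) (c : R -> T) : Prop :=
  [/\ c 0 = x, c (d x y) = y &
      {in `[0, d x y] &, forall s t, d (c s) (c t) = `|s - t|}].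

Definition geodesic_segment (x y : T) (S : set T) : Prop :=
  exists2 c, geodesic_path x y c & S = c @` `[0, d x y].

Definition geodesic_space : Prop :=
  forall x y, exists S, geodesic_segment x y S.

(* The vertices are [p 0], [p 1], [p 2]; the side [S i] joins [p i] to the
   cyclically next vertex [p (ordS i)]. *)
Definition geodesic_triangle (p : 'I_3 -> T) (S : 'I_3 -> set T) : Prop :=
  forall i, geodesic_segment (p i) (p (ordS i)) (S i).

Definition perimeter (p : 'I_3 -> T) : R := \sum_i d (p i) (p (ordS i)).

Definition diameter (A : set T) : \bar R :=
  ereal_sup [set (d x y)%:E | x in A & y in A].

End Geodesics.

Section ModelSurfaces.
Context {R : realType}.

Definition dotv n (v w : 'rV[R]_n) : R := \sum_i v 0 i * w 0 i.

Definition sphere2 := {v : 'rV[R]_3 | dotv v v == 1}.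

Definition sphere_dist (v w : sphere2) : R := acos (dotv (val v) (val w)).

(* Not the norm of ['rV[R]_2] in the library, which is the sup norm. *)
Definition plane_dist (v w : 'rV[R]_2) : R := Num.sqrt (dotv (v - w) (v - w)).

(* Hyperboloid model: the upper sheet of lorentz v v = -1, with distance given
   by cosh (dist v w) = - lorentz v w. *)
Definition lorentz (v w : 'rV[R]_3) : R :=
  - (v 0 0 * w 0 0) + v 0 1 * w 0 1 + v 0 2%:R * w 0 2%:R.

Definition hyperboloid :=
  {v : 'rV[R]_3 | (lorentz v v == -1) && (0 < v 0 0)}.

Definition arcosh (x : R) : R := ln (x + Num.sqrt (x ^+ 2 - 1)).

Definition hyperbolic_dist (v w : hyperboloid) : R :=
  arcosh (- lorentz (val v) (val w)).

Record surface := Surface { spoint : Type ; sdist : spoint -> spoint -> R }.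

Definition model_surface (k : R) : surface :=
  if 0 < k then Surface (fun v w : sphere2 => sphere_dist v w / Num.sqrt k)
  else if k == 0 then Surface plane_dist
  else Surface
    (fun v w : hyperboloid => hyperbolic_dist v w / Num.sqrt (- k)).

Definition model_diam (k : R) : \bar R :=
  if 0 < k then (pi / Num.sqrt k)%:E else +oo%E.

End ModelSurfaces.

Section CAT.
Context {R : realType}.

Definition comparison_triangle {T M : Type} (d : T -> T -> R)
    (dM : M -> M -> R) (p : 'I_3 -> T) (q : 'I_3 -> M) (SM : 'I_3 -> set M) :=
  geodesic_triangle dM q SM /\
  forall i, dM (q i) (q (ordS i)) = d (p i) (p (ordS i)).

(* The comparison point of [x] on the side [S i] is the point [x'] on the side
   [SM i] at the same distance from the [i]-th vertex. *)
Definition CAT_inequality {T M : Type} (d : T -> T -> R) (dM : M -> M -> R)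
    (p : 'I_3 -> T) (S : 'I_3 -> set T)
    (q : 'I_3 -> M) (SM : 'I_3 -> set M) : Prop :=
  forall i j x y x' y',
    S i x -> SM i x' -> dM (q i) x' = d (p i) x ->
    S j y -> SM j y' -> dM (q j) y' = d (p j) y ->
    d x y <= dM x' y'.

Definition CAT (k : R) (X : metricType R) : Prop :=
  let d := @mdist R X in
  let dM := @sdist R (model_surface k) in
  geodesic_space d /\
  forall p S, geodesic_triangle d p S ->
    ((perimeter d p)%:E < 2%:E * model_diam k)%E ->
    exists q SM, comparison_triangle d dM p q SM /\
                 CAT_inequality d dM p S q SM.

End CAT.

(* Main.v *)
Require Import Defs.
From mathcomp Require Import all_boot all_order all_algebra.
From mathcomp Require Import all_classical all_reals all_analysis.
From mathcomp Require Import ring lra.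

Set Implicit Arguments.
Unset Strict Implicit.
Unset Printing Implicit Defensive.

Import Order.TTheory GRing.Theory Num.Theory.
Import numFieldNormedType.Exports.

Local Open Scope classical_set_scope.
Local Open Scope ring_scope.

(** Write r for the infimum of the weighted radius f(x) = sup_p u(p) d(x,p).
Points where f is almost r form decreasing nonempty sets as the tolerance
shrinks to 0, and both existence and uniqueness of the minimum follow from
completeness once the diameters of these sets tend to 0
([sublevels_inter1], [sublevels_shrink]).

The diameters tend to 0 because balls of radius less than D_k/2 are uniformly
convex: if x and y are at distance at most a from z, where a <= A < D_k/2, and
d(x,y) >= e, then their midpoint m satisfies d(m,z) <= a - kappa with kappa > 0
depending only on k, A and e.  If f(x) and f(y) were almost r with
d(x,y) >= e, then f(m) would fall below r.  Indeed u(p) d(m,p) drops by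
u(p) kappa, a definite amount for the p whose weight is bounded below, while
the p of small weight contribute at most r/2 because all distances are at
most A.  (This is for r > 0; if r = 0, one p of positive weight suffices.)

The diameter hypothesis gives the bound A.  Let delta be the diameter of P,
M the supremum of u, and l a point of P whose weight is almost M.  Since
r <= M delta, an almost optimal x has d(x,l) almost at most delta, hence
d(x,p) is almost at most 2 delta < D_k/2 for every p in P
([sublevel_near]).

Uniform convexity is transferred to X by the comparison inequality for the
triangle (x,y,z), of perimeter at most 4 A < 2 D_k
([CAT_uniform_midpoints]), from the three kinds of model surface.  There it is
an explicit computation: the midpoint m of x and y is the normalized sum of the
vectors x and y, so that a linear form in m is the average of its values at x
and y, divided by cos (d(x,y)/2) on the sphere and by cosh (d(x,y)/2) on the
hyperboloid.  Applied to the linear form that expresses the distance to z,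
this yields the law of the median ([sphere_midpoint],
[hyperbolic_midpoint]), from which the estimates follow. *)

(** * Uniform convexity of balls *)

(** The midpoint [m] is characterized by its two distances, and the bound
[d x y <= 2 * A] is assumed rather than deduced, so that the notion can be
checked on the model surfaces without their triangle inequality or symmetry.
The order of the arguments of [d] is that of the sides of a triangle
(x, y, z). *)
Definition uniformly_convex_balls {R : realType} {T : Type}
    (d : T -> T -> R) (A : R) : Prop :=
  forall e, 0 < e -> exists2 kappa, 0 < kappa &
    forall a x y z m, a <= A -> d y z <= a -> d z x <= a ->
      e <= d x y -> d x y <= 2 * A ->
      d x m = d x y / 2 -> d m y = d x y / 2 -> d m z <= a - kappa.

Lemma scaled_uniformly_convex_balls {R : realType} {T : Type}
    (d : T -> T -> R) (A t : R) : 0 < t ->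
  uniformly_convex_balls d (A * t) ->
  uniformly_convex_balls (fun x y => d x y / t) A.
Proof.
move=> t0 dconv e e0.
have [kappa kappa0 gap] := dconv (e * t) (mulr_gt0 e0 t0).
exists (kappa / t); first exact: divr_gt0.
move=> a x y z m aA yz zx exy xyA xm my.
have tN0 : t != 0 by rewrite gt_eqF.
have dE p q : d p q = d p q / t * t by rewrite divfK.
rewrite ler_pdivrMr // mulrBl divfK //.
apply: (gap (a * t) x y).
- by rewrite ler_pM2r.
- by rewrite -ler_pdivrMr.
- by rewrite -ler_pdivrMr.
- by rewrite -ler_pdivlMr.
- by rewrite mulrA -ler_pdivrMr.
- by rewrite [LHS]dE xm; field.
- by rewrite [LHS]dE my; field.
Qed.

(** * The Euclidean plane *)

Section DotProduct.
Context {R : realType} {n : nat}.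
Implicit Types (u v w : 'rV[R]_n) (a : R).

Lemma dotvC u v : dotv u v = dotv v u.
Proof. by apply: eq_bigr => i _; rewrite mulrC. Qed.

Lemma dotvDl u v w : dotv (u + v) w = dotv u w + dotv v w.
Proof. by rewrite -big_split; apply: eq_bigr => i _; rewrite mxE mulrDl. Qed.

Lemma dotvZl a u w : dotv (a *: u) w = a * dotv u w.
Proof.
by rewrite /dotv mulr_sumr; apply: eq_bigr => i _; rewrite mxE mulrA.
Qed.

Lemma dotvNl u w : dotv (- u) w = - dotv u w.
Proof. by rewrite -scaleN1r dotvZl mulN1r. Qed.

Lemma dotvDr u v w : dotv w (u + v) = dotv w u + dotv w v.
Proof. by rewrite !(dotvC w) dotvDl. Qed.

Lemma dotvZr a u w : dotv w (a *: u) = a * dotv w u.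
Proof. by rewrite !(dotvC w) dotvZl. Qed.

Lemma dotvNr u w : dotv w (- u) = - dotv w u.
Proof. by rewrite !(dotvC w) dotvNl. Qed.

Lemma dotv_ge0 u : 0 <= dotv u u.
Proof. by apply: sumr_ge0 => i _; rewrite -expr2 sqr_ge0. Qed.

Lemma dotv_eq0 u : dotv u u = 0 -> u = 0.
Proof.
move/eqP; rewrite psumr_eq0 => [/allP u0|i _]; last by rewrite -expr2 sqr_ge0.
apply/rowP => i; rewrite mxE; apply/eqP.
by have := u0 i; rewrite mem_index_enum -expr2 sqrf_eq0 => /(_ isT).
Qed.

End DotProduct.

Definition dotv_expand :=
  (@dotvDl, @dotvDr, @dotvNl, @dotvNr, @dotvZl, @dotvZr).

(** The parallelogram law gives
d(m,z)^2 = (d(x,z)^2 + d(y,z)^2)/2 - d(x,y)^2/4, which is at most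
a^2 - e^2/4. *)
Lemma plane_uniformly_convex_balls {R : realType} (A : R) : 0 < A ->
  uniformly_convex_balls (@plane_dist R) A.
Proof.
move=> A0 e e0; exists (e ^+ 2 / (8 * A)).
  by rewrite divr_gt0 ?exprn_gt0 ?mulr_gt0.
move=> a x y z m aA yz zx exy xyA xm my.
have distE (v w : 'rV[R]_2) : plane_dist v w ^+ 2 = dotv (v - w) (v - w).
  by rewrite sqr_sqrtr ?dotv_ge0.
have dist0 (v w : 'rV[R]_2) : 0 <= plane_dist v w by exact: sqrtr_ge0.
have mE : x + y - 2 *: m = 0.
  (* By the parallelogram law |x + y - 2 m|^2 = 2 |x - m|^2 + 2 |m - y|^2
     - |x - y|^2 = 0. *)
  apply: dotv_eq0.
  have := distE x y; have := distE x m; have := distE m y.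
  rewrite xm my; move: (plane_dist x y) => s.
  rewrite !dotv_expand (dotvC y x) (dotvC m x) (dotvC y m).
  lra.
have key : plane_dist m z ^+ 2 = plane_dist y z ^+ 2 / 2
   + plane_dist z x ^+ 2 / 2 - plane_dist x y ^+ 2 / 4.
  have zE : m = 2^-1 *: (x + y).
    by move/subr0_eq: mE => ->; rewrite scalerA mulVf ?scale1r.
  rewrite !distE zE !dotv_expand (dotvC y x) (dotvC z x) (dotvC z y).
  by field.
have yz0 := dist0 y z; have zx0 := dist0 z x; have mz0 := dist0 m z.
have yza : plane_dist y z ^+ 2 <= a ^+ 2 by nra.
have zxa : plane_dist z x ^+ 2 <= a ^+ 2 by nra.
have xye : e ^+ 2 <= plane_dist x y ^+ 2 by nra.
have a0 : 0 <= a by lra.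
have mza : plane_dist m z <= a by nra.
(* (a - d(m,z)) (a + d(m,z)) >= e^2 / 4, and a + d(m,z) <= 2 A *)
rewrite lerBrDr -lerBrDl ler_pdivrMr ?mulr_gt0 //.
nra.
Qed.

(** * The sphere *)

Section Sphere.
Context {R : realType}.
Implicit Types (x y z m v w : @sphere2 R) (a b s : R).

Lemma cos_half s : cos s = 2 * cos (s / 2) ^+ 2 - 1.
Proof. by rewrite {1}[s]splitr cosD -!expr2 sin2cos2; ring. Qed.

Lemma cosB_le a b : b <= a -> cos b - cos a <= a - b.
Proof.
move=> ba.
have cont : {within `[b, a], continuous (@cos R)}.
  by apply: continuous_subspaceT => t; exact: continuous_cos.
have [c _ E] := MVT_segment ba (fun t _ => is_derive_cos t) cont.
have := sin_le1 c.
have ->: cos b - cos a = sin c * (a - b) by rewrite -opprB E; ring.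
by move=> sc; rewrite ler_piMl ?subr_ge0.
Qed.

Lemma dotv_sphere v : dotv (val v) (val v) = 1.
Proof. exact/eqP/(valP v). Qed.

Lemma dotv_sphere_bound v w : -1 <= dotv (val v) (val w) <= 1.
Proof.
have := dotv_ge0 (val v - val w); have := dotv_ge0 (val v + val w).
rewrite !dotv_expand !dotv_sphere (dotvC (val w) (val v)).
by move=> *; apply/andP; split; lra.
Qed.

Lemma cos_sphere_dist v w : cos (sphere_dist v w) = dotv (val v) (val w).
Proof. by rewrite acosK // in_itv /= dotv_sphere_bound. Qed.

Lemma sphere_dist_itv v w : 0 <= sphere_dist v w <= pi.
Proof. by rewrite acos_ge0 ?acos_lepi ?dotv_sphere_bound. Qed.

(** The vector x + y - 2 cos (d(x,y)/2) m has norm 0 by the double angle formula,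
hence its scalar product with z vanishes. *)
Lemma sphere_midpoint x y z m :
  sphere_dist x m = sphere_dist x y / 2 ->
  sphere_dist m y = sphere_dist x y / 2 ->
  cos (sphere_dist y z) + cos (sphere_dist z x) =
    2 * cos (sphere_dist x y / 2) * cos (sphere_dist m z).
Proof.
move=> /(congr1 cos) + /(congr1 cos).
have := cos_half (sphere_dist x y).
move: (cos (_ / 2)) => c; rewrite !cos_sphere_dist => xy xm my.
have /dotv_eq0 sum0 : dotv (val x + val y - (2 * c) *: val m)
    (val x + val y - (2 * c) *: val m) = 0.
  rewrite !dotv_expand !dotv_sphere (dotvC (val y) (val x)) (dotvC (val y)).
  by rewrite (dotvC (val m) (val x)) xy xm my; ring.
rewrite (dotvC (val z)) addrC -dotvDl -dotvZl.
by move/subr0_eq: sum0 => ->.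
Qed.

(** By [sphere_midpoint], cos d(m,z) >= cos a / cos (d(x,y)/2), which exceeds
cos a by at least cos A (1 - cos (d(x,y)/2)); here cos A > 0 because
A < pi/2.  As cos is 1-Lipschitz, the same gap separates d(m,z) from a. *)
Lemma sphere_uniformly_convex_balls A : 0 < A -> 2 * A < pi ->
  uniformly_convex_balls (@sphere_dist R) A.
Proof.
move=> A0 Api e e0.
have pi2 : 2 <= (pi : R) by exact: pi_ge2.
(* The truncation keeps e1 / 2 in the range where cos is decreasing. *)
pose e1 := Num.min e 1.
have e10 : 0 < e1 by rewrite lt_min e0 ltr01.
have e11 : e1 <= 1 by rewrite ge_min lexx orbT.
have lt_cos a b : 0 <= a -> a < b -> b <= pi -> cos b < cos a.
  by move=> a0 ab bpi; rewrite ltr_cos // in_itv /=; apply/andP; split; lra.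
have le_cos a b : 0 <= a -> a <= b -> b <= pi -> cos b <= cos a.
  by move=> a0; rewrite le_eqVlt => /predU1P[->//|ab] bpi; exact/ltW/lt_cos.
have cosA : 0 < cos A by apply: cos_gt0_pihalf; apply/andP; split; lra.
have cose : cos (e1 / 2) < 1.
  by rewrite -[ltRHS]cos0; apply: lt_cos; lra.
exists (cos A * (1 - cos (e1 / 2))); first by rewrite mulr_gt0 ?subr_gt0.
move=> a x y z m aA yz zx exy xyA xm my.
have /andP[yz0 _] := sphere_dist_itv y z.
have /andP[zx0 _] := sphere_dist_itv z x.
have /andP[mz0 mzpi] := sphere_dist_itv m z.
have e1xy : e1 <= sphere_dist x y by rewrite ge_min exy.
have mid := sphere_midpoint z xm my.
have cxy0 : 0 < cos (sphere_dist x y / 2).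
  by apply: cos_gt0_pihalf; apply/andP; split; lra.
have cxy1 : cos (sphere_dist x y / 2) <= cos (e1 / 2) by apply: le_cos; lra.
have cyz : cos a <= cos (sphere_dist y z) by apply: le_cos; lra.
have czx : cos a <= cos (sphere_dist z x) by apply: le_cos; lra.
have cAa : cos A <= cos a by apply: le_cos; lra.
have cmz : cos a <= cos (sphere_dist x y / 2) * cos (sphere_dist m z) by lra.
have gap : cos a + cos A * (1 - cos (e1 / 2)) <= cos (sphere_dist m z).
  have cmz0 : 0 < cos (sphere_dist m z).
    by rewrite -(pmulr_rgt0 _ cxy0); lra.
  have camz : cos a <= cos (sphere_dist m z).
    by rewrite (le_trans cmz) // ler_piMl ?(ltW cmz0) //; lra.
  nra.
have [mza|amz] := leP (sphere_dist m z) a; first by have := cosB_le mza; lra.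
have := lt_cos a (sphere_dist m z); nra.
Qed.

End Sphere.

(** * The hyperbolic plane *)

Section Hyperbolic.
Context {R : realType}.
Implicit Types (x y z m v w : @hyperboloid R) (a b s : R).

Definition cosh s : R := (expR s + expR (- s)) / 2.

Lemma cosh_half s : cosh s = 2 * cosh (s / 2) ^+ 2 - 1.
Proof.
rewrite /cosh {1 2}[s]splitr opprD !expRD.
have : expR (s / 2) * expR (- (s / 2)) = 1.
  by rewrite expRN divff ?gt_eqF ?expR_gt0.
move: (expR (s / 2)) (expR (- (s / 2))) => p q pq.
by rewrite -[X in _ - X]pq; field.
Qed.

Lemma le_cosh a b : 0 <= b -> b <= a -> cosh b <= cosh a.
Proof.
move=> b0 ba; rewrite /cosh ler_pM2r ?invr_gt0 //.
have Eb : expR b * expR (- b) = 1 by rewrite expRN divff ?gt_eqF ?expR_gt0.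
have Ea : expR a * expR (- a) = 1 by rewrite expRN divff ?gt_eqF ?expR_gt0.
have b1 : 1 <= expR b by rewrite -expR0 ler_expR.
have ab : expR b <= expR a by rewrite ler_expR.
have : 0 <= (expR a - expR b) * (1 - expR (- b) * expR (- a)).
  rewrite mulr_ge0 ?subr_ge0 // mulr_ile1 ?expR_ge0 //.
    by rewrite -expR0 ler_expR oppr_le0.
  by rewrite -expR0 ler_expR oppr_le0 (le_trans b0).
have -> : (expR a - expR b) * (1 - expR (- b) * expR (- a)) =
    expR a - expR b - expR (- b) * (expR a * expR (- a))
      + expR b * expR (- b) * expR (- a) by ring.
rewrite Ea Eb; lra.
Qed.

Lemma cosh_ge1 a : 0 <= a -> 1 <= cosh a.
Proof.
move=> a0; have := le_cosh (lexx 0) a0.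
suff -> : cosh 0 = 1 by [].
by rewrite /cosh oppr0 expR0; field.
Qed.

Lemma cosh_gt1 a : 0 < a -> 1 < cosh a.
Proof.
move=> a0; rewrite /cosh expRN ltr_pdivlMr // mul1r.
have a1 : 1 < expR a by rewrite -expR0 ltr_expR.
have ea0 : 0 < expR a by exact: expR_gt0.
rewrite -(ltr_pM2r ea0) [ltRHS]mulrDl mulVf ?gt_eqF //.
nra.
Qed.

Lemma coshB_le a b : b <= a -> cosh a - cosh b <= (a - b) * expR a.
Proof.
move=> ba; have := expR_ge1Dx (b - a); rewrite expRD expRN.
have ea : 0 < expR a by exact: expR_gt0.
rewrite -(ler_pM2r ea) mulfVK ?gt_eqF // => H.
have nab : expR (- a) <= expR (- b) by rewrite ler_expR lerN2.
rewrite /cosh; nra.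
Qed.

Lemma lorentz_hyperboloid v : lorentz (val v) (val v) = -1.
Proof. by have /andP[/eqP] := valP v. Qed.

Lemma hyperboloid_gt0 v : 0 < val v 0 0.
Proof. by have /andP[] := valP v. Qed.

(** The reverse Cauchy-Schwarz inequality for future timelike unit vectors: it
puts the argument of [arcosh] in its domain. *)
Lemma lorentz_le v w : lorentz (val v) (val w) <= -1.
Proof.
have := lorentz_hyperboloid v; have := lorentz_hyperboloid w.
have := hyperboloid_gt0 v; have := hyperboloid_gt0 w.
rewrite /lorentz.
move: (val v 0 0) (val v 0 1) (val v 0 2%:R) => v0 v1 v2.
move: (val w 0 0) (val w 0 1) (val w 0 2%:R) => w0 w1 w2 w0_gt0 v0_gt0 ww vv.
suff : 1 + (v1 * w1 + v2 * w2) <= v0 * w0 by lra.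
have vw0 : 0 <= v0 * w0 by rewrite mulr_ge0 ?ltW.
apply: le_trans (ler_norm _) _.
rewrite -(ler_pXn2r (n := 2)) ?nnegrE // real_normK ?num_real // exprMn.
have -> : v0 ^+ 2 = 1 + v1 ^+ 2 + v2 ^+ 2 by lra.
have -> : w0 ^+ 2 = 1 + w1 ^+ 2 + w2 ^+ 2 by lra.
have := sqr_ge0 (v1 * w2 - v2 * w1).
have := sqr_ge0 (v1 - w1); have := sqr_ge0 (v2 - w2).
lra.
Qed.

Lemma arcosh_ge0 s : 1 <= s -> 0 <= arcosh s.
Proof. by move=> s1; rewrite ln_ge0 // (le_trans s1) // lerDl sqrtr_ge0. Qed.

Lemma arcoshK s : 1 <= s -> cosh (arcosh s) = s.
Proof.
move=> s1; rewrite /cosh expRN lnK; last first.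
  by rewrite posrE (lt_le_trans ltr01) // (le_trans s1) // lerDl sqrtr_ge0.
have s2 : 0 <= s ^+ 2 - 1 by rewrite subr_ge0 expr_ge1 // (le_trans ler01).
have t0 := sqrtr_ge0 (s ^+ 2 - 1); have t2 := sqr_sqrtr s2.
move: (Num.sqrt _) t0 t2 => t t0 t2.
have -> : (s + t)^-1 = s - t.
  apply: (mulfI (x := s + t)); first by rewrite gt_eqF //; lra.
  rewrite mulfV; last by rewrite gt_eqF //; lra.
  by rewrite [RHS]mulrC -subr_sqr t2; ring.
by field.
Qed.

Lemma cosh_hyperbolic_dist v w :
  cosh (hyperbolic_dist v w) = - lorentz (val v) (val w).
Proof. by rewrite arcoshK // lerNr lorentz_le. Qed.

Lemma hyperbolic_dist_ge0 v w : 0 <= hyperbolic_dist v w.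
Proof. by rewrite arcosh_ge0 // lerNr lorentz_le. Qed.

(** The Lorentz form is definite on the orthogonal of a timelike vector, so a null
vector in that orthogonal is zero. *)
Lemma lorentz_orthogonal_null (n : 'rV[R]_3) m :
  lorentz n (val m) = 0 -> lorentz n n = 0 -> forall u, lorentz n u = 0.
Proof.
move=> nm nn u; have := lorentz_hyperboloid m; move: nm nn; rewrite /lorentz.
move: (n 0 0) (n 0 1) (n 0 2%:R) => n0 n1 n2.
move: (val m 0 0) (val m 0 1) (val m 0 2%:R) => m0 m1 m2 nm nn mm.
have n00 : n0 = 0.
  apply/eqP; rewrite -sqrf_eq0 eq_le sqr_ge0 andbT.
  have : (n0 * m0) ^+ 2 <= (n1 ^+ 2 + n2 ^+ 2) * (m1 ^+ 2 + m2 ^+ 2).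
    have -> : n0 * m0 = n1 * m1 + n2 * m2 by lra.
    by have := sqr_ge0 (n1 * m2 - n2 * m1); lra.
  have -> : n1 ^+ 2 + n2 ^+ 2 = n0 ^+ 2 by lra.
  have -> : m1 ^+ 2 + m2 ^+ 2 = m0 ^+ 2 - 1 by lra.
  lra.
have n10 : n1 = 0.
  apply/eqP; rewrite -sqrf_eq0 eq_le sqr_ge0 andbT.
  by have := sqr_ge0 n2; rewrite n00 in nn; lra.
have n20 : n2 = 0.
  by apply/eqP; rewrite -sqrf_eq0; apply/eqP; rewrite n00 n10 in nn; lra.
by rewrite n00 n10 n20; ring.
Qed.

(** The vector n = x + y - 2 cosh (d(x,y)/2) m is null; unlike on the sphere this
does not make it zero by itself, but n is also orthogonal to m. *)
Lemma hyperbolic_midpoint x y z m :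
  hyperbolic_dist x m = hyperbolic_dist x y / 2 ->
  hyperbolic_dist m y = hyperbolic_dist x y / 2 ->
  cosh (hyperbolic_dist y z) + cosh (hyperbolic_dist z x) =
    2 * cosh (hyperbolic_dist x y / 2) * cosh (hyperbolic_dist m z).
Proof.
move=> /(congr1 cosh) + /(congr1 cosh).
have := cosh_half (hyperbolic_dist x y).
move: (cosh (_ / 2)) => c; rewrite !cosh_hyperbolic_dist => xy xm my.
pose n := val x + val y - (2 * c) *: val m.
have nE (u : 'rV[R]_3) : lorentz n u =
    lorentz (val x) u + lorentz (val y) u - 2 * c * lorentz (val m) u.
  by rewrite /lorentz !mxE; ring.
have lorentzC (u v : 'rV[R]_3) : lorentz u v = lorentz v u.
  by rewrite /lorentz; ring.
have := lorentz_orthogonal_null (n := n) (m := m) _ _ (val z).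
rewrite (nE (val m)) (nE n) !(lorentzC _ n) !nE !lorentz_hyperboloid.
rewrite (lorentzC (val y) (val x)) (lorentzC (val y) (val m)).
rewrite (lorentzC (val m) (val x)) (lorentzC (val z)).
have -> : lorentz (val x) (val y) = 1 - 2 * c ^+ 2 by lra.
have -> : lorentz (val x) (val m) = - c by lra.
have -> : lorentz (val m) (val y) = - c by lra.
move=> H; have := H ltac:(ring) ltac:(ring); lra.
Qed.

(** By [hyperbolic_midpoint], cosh d(m,z) <= cosh a / cosh (d(x,y)/2), which is
below cosh a by at least 1 - 1 / cosh (e/2); the factor exp (- A) accounts for
the Lipschitz constant of cosh on [0, A]. *)
Lemma hyperbolic_uniformly_convex_balls A :
  uniformly_convex_balls (@hyperbolic_dist R) A.
Proof.
move=> e e0.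
have ce1 : 1 < cosh (e / 2) by rewrite cosh_gt1 ?divr_gt0.
have ceV1 : (cosh (e / 2))^-1 < 1 by rewrite invf_lt1 // (lt_trans ltr01).
exists ((1 - (cosh (e / 2))^-1) * expR (- A)).
  by rewrite mulr_gt0 ?expR_gt0 ?subr_gt0.
move=> a x y z m aA yz zx exy xyA xm my.
have yz0 := hyperbolic_dist_ge0 y z.
have zx0 := hyperbolic_dist_ge0 z x.
have mz0 := hyperbolic_dist_ge0 m z.
have a0 : 0 <= a by lra.
have mid := hyperbolic_midpoint z xm my.
have cyz : cosh (hyperbolic_dist y z) <= cosh a by exact: le_cosh.
have czx : cosh (hyperbolic_dist z x) <= cosh a by exact: le_cosh.
have cxy : cosh (e / 2) <= cosh (hyperbolic_dist x y / 2).
  by apply: le_cosh; lra.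
have cmz := cosh_ge1 mz0.
have ca := cosh_ge1 a0.
have cmz' : cosh (e / 2) * cosh (hyperbolic_dist m z) <= cosh a by nra.
have ce0 : 0 < cosh (e / 2) by lra.
have gap : cosh (hyperbolic_dist m z) <= cosh a - (1 - (cosh (e / 2))^-1).
  have : cosh (hyperbolic_dist m z) <= cosh a / cosh (e / 2).
    by rewrite ler_pdivlMr // mulrC.
  nra.
have mza : hyperbolic_dist m z <= a.
  rewrite leNgt; apply/negP => amz.
  by have := le_cosh a0 (ltW amz); lra.
have := coshB_le mza.
have eaA : expR a <= expR A by rewrite ler_expR.
have amz0 : 0 <= a - hyperbolic_dist m z by rewrite subr_ge0.
move=> H.
rewrite expRN lerBrDr -lerBrDl ler_pdivrMr ?expR_gt0 //.
nra.
Qed.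

End Hyperbolic.

(** * Midpoints in CAT(k) spaces *)

Lemma model_surface_uniformly_convex_balls {R : realType} (k A : R) : 0 < A ->
  ((2 * A)%:E < model_diam k)%E ->
  uniformly_convex_balls (@sdist R (model_surface k)) A.
Proof.
rewrite /model_diam /model_surface => A0.
case: ifPn => [k0|kle0 _].
  rewrite lte_fin => Ak; have sk0 : 0 < Num.sqrt k by rewrite sqrtr_gt0.
  apply: scaled_uniformly_convex_balls => //.
  apply: sphere_uniformly_convex_balls; first exact: mulr_gt0.
  by rewrite mulrA -ltr_pdivlMr.
case: ifPn => [_|kN0]; first exact: plane_uniformly_convex_balls.
apply: scaled_uniformly_convex_balls.
  by rewrite sqrtr_gt0 oppr_gt0 lt_neqAle kN0 leNgt.
exact: hyperbolic_uniformly_convex_balls.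
Qed.

Lemma geodesic_path_midpoint {R : realType} {T : Type} (d : T -> T -> R) x y c :
  0 <= d x y -> geodesic_path d x y c ->
  d x (c (d x y / 2)) = d x y / 2 /\ d (c (d x y / 2)) y = d x y / 2.
Proof.
move=> d0 [c0 c1 iso].
have i0 : 0 \in `[0, d x y] by rewrite in_itv /= lexx.
have i1 : d x y \in `[0, d x y] by rewrite in_itv /= lexx andbT.
have ih : d x y / 2 \in `[0, d x y] by rewrite in_itv /=; apply/andP; split; lra.
split.
  by rewrite -[X in d X _ = _]c0 iso // sub0r normrN ger0_norm // divr_ge0.
rewrite -[X in d _ X = _]c1 iso // distrC ger0_norm; lra.
Qed.

(** A single m serves for all z: this is what makes it a better centre than x and
y for a whole family of points at once. *)
Definition uniform_midpoints {R : realType} (X : metricType R) (A : R) : Prop :=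
  forall e, 0 < e ->
  exists2 kappa, 0 < kappa &
    forall x y : X, e <= mdist x y <= 2 * A ->
      exists m : X, forall z a, a <= A -> mdist x z <= a -> mdist y z <= a ->
        mdist m z <= a - kappa.

(** The points compared are m, on the first side of the triangle (x, y, z), and the
vertex z, seen as the origin of the third side; the comparison point of m is the
midpoint of the corresponding side in the model surface. *)
Lemma CAT_uniform_midpoints {R : realType} (k : R) (X : metricType R) (A : R) :
  CAT k X -> 0 < A -> ((2 * A)%:E < model_diam k)%E -> uniform_midpoints X A.
Proof.
move=> [geod cat] A0 Ak e e0.
have [kappa kappa0 gap] :=
  model_surface_uniformly_convex_balls A0 Ak e0.
exists kappa => // x y /andP[exy xyA].
have [Sxy [cxy pxy ExySxy]] := geod x y.
have dxy0 : 0 <= mdist x y by exact: mdist_ge0.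
have [xm my] := geodesic_path_midpoint dxy0 pxy.
set m := cxy _ in xm my; exists m => z a aA xz yz.
have [Syz gyz] := geod y z; have [Szx gzx] := geod z x.
pose p (i : 'I_3) := nth x [:: x; y; z] i.
pose S (i : 'I_3) := nth Sxy [:: Sxy; Syz; Szx] i.
have tri : geodesic_triangle (@mdist R X) p S.
  by case=> [[|[|[|//]]] i3]; rewrite /p /S /=; first by exists cxy.
have perE : perimeter (@mdist R X) p = mdist x y + mdist y z + mdist z x.
  by rewrite /perimeter !big_ord_recl big_ord0 addr0 addrA.
have per : ((perimeter (@mdist R X) p)%:E < 2%:E * model_diam k)%E.
  apply: (@le_lt_trans _ _ (2%:E * (2 * A)%:E)%E); last by rewrite lte_pmul2l.
  by rewrite perE (metric_sym z x) -EFinM lee_fin; lra.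
have [q [SM [[triM dq] ineq]]] := cat p S tri per.
pose i0 : 'I_3 := ord0; pose i1 : 'I_3 := ordS i0; pose i2 : 'I_3 := ordS i1.
have i20 : ordS i2 = i0 by exact: val_inj.
have [c0 pc0 S0] := triM i0; have [c2 pc2 S2] := triM i2.
have d01 : sdist (q i0) (q i1) = mdist x y by exact: (dq i0).
have d12 : sdist (q i1) (q i2) = mdist y z by exact: (dq i1).
have d20 : sdist (q i2) (q i0) = mdist z x by rewrite -i20; exact: (dq i2).
have dq0 : 0 <= sdist (q i0) (q i1) by rewrite d01.
have [xm' m'y] := geodesic_path_midpoint dq0 pc0.
set m' := c0 _ in xm' m'y.
have half_in s : 0 <= s -> s / 2 \in `[(0 : R), s].
  by move=> s0; rewrite in_itv /=; apply/andP; split; lra.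
have q22 : sdist (q i2) (q i2) = 0.
  have [c20 _ iso] := pc2; rewrite -c20 iso ?subrr ?normr0 //.
    by rewrite in_itv /= lexx i20 d20 mdist_ge0.
  by rewrite in_itv /= lexx i20 d20 mdist_ge0.
have mz : mdist m z <= sdist m' (q i2).
  apply: (ineq i0 i2).
  - by rewrite /S /= ExySxy; exists (mdist x y / 2) => //; exact: half_in.
  - by rewrite S0; exists (sdist (q i0) (q i1) / 2) => //; exact: half_in.
  - by rewrite xm' d01 -xm.
  - have [c pc Szxc] := gzx; have [cz _ _] := pc.
    rewrite /S /= Szxc; exists 0 => //.
    by rewrite /= in_itv /= lexx mdist_ge0.
  - have [c20 _ _] := pc2; rewrite S2; exists 0 => //.
    by rewrite /= in_itv /= lexx i20 d20 mdist_ge0.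
  - by rewrite q22 mdistxx.
apply: le_trans mz (gap a (q i0) (q i1) (q i2) m' aA _ _ _ _ xm' m'y).
- by rewrite d12.
- by rewrite d20 metric_sym.
- by rewrite d01.
- by rewrite d01.
Qed.

(** * Sublevel sets of the weighted radius *)

Section WeightedRadius.
Context {R : realType} {X : metricType R} {I : Type} (pt : I -> X) (u : I -> R).

(** The set where the weighted radius sup_i u(i) d(x, pt i) is at most [c], stated
without the supremum, which need not be finite. *)
Definition sublevel (c : R) : set X :=
  [set x | forall i, u i * mdist x (pt i) <= c].

(** For r > 0, two almost optimal points at distance at least e would have a
midpoint of weighted radius less than r.  For r = 0 there is nothing below r to
reach, but then a single index of positive weight forces all almost optimal
points close to its point. *)
Lemma sublevels_shrink (A r e0 : R) :
  (forall i, 0 <= u i) -> (exists i, 0 < u i) -> 0 < A -> 0 <= r ->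
  (forall c, sublevel c !=set0 -> r <= c) ->
  0 < e0 -> sublevel (r + e0) `<=` [set x | forall i, mdist x (pt i) <= A] ->
  uniform_midpoints X A ->
  forall e, 0 < e -> exists2 eta, 0 < eta &
    forall x y, sublevel (r + eta) x -> sublevel (r + eta) y -> mdist x y < e.
Proof.
move=> u0 [j uj] A0 r0 rmin e0_gt0 near_pt mids e e_gt0.
have [->|rN0] := eqVneq r 0.
  exists (u j * e / 3); first by rewrite !mulr_gt0.
  move=> x y /(_ j) xj /(_ j) yj.
  have xj' : mdist x (pt j) <= e / 3.
    by rewrite -(ler_pM2l uj) (le_trans xj) // add0r mulrA.
  have yj' : mdist y (pt j) <= e / 3.
    by rewrite -(ler_pM2l uj) (le_trans yj) // add0r mulrA.
  have := metric_triangle x (pt j) y; rewrite (metric_sym (pt j)); lra.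
have r_gt0 : 0 < r by rewrite lt_neqAle eq_sym rN0.
have [kappa kappa0 mid] := mids e e_gt0.
(* lambda separates the small weights, for which u(i) A <= r / 2, from those for
   which a gain of kappa in the distance is a gain of lambda kappa in the value. *)
have [lambda lambda0 lambdaA] : exists2 lambda, 0 < lambda & lambda * A = r / 2.
  exists (r / (2 * A)); first by rewrite divr_gt0 ?mulr_gt0.
  by field; rewrite gt_eqF.
pose eta := Num.min e0 (lambda * kappa / 2).
have eta0 : 0 < eta by rewrite lt_min e0_gt0 divr_gt0 ?mulr_gt0.
have eta_e0 : eta <= e0 by rewrite ge_min lexx.
have eta_lk : eta <= lambda * kappa / 2 by rewrite ge_min lexx orbT.
exists eta => // x y xS yS; rewrite ltNge; apply/negP => exy.
have bound w i : sublevel (r + eta) w -> mdist w (pt i) <= A.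
  by move=> wS; apply: near_pt => k; rewrite (le_trans (wS k)) // lerD2l.
have xyA : mdist x y <= 2 * A.
  have := metric_triangle x (pt j) y; rewrite (metric_sym (pt j)).
  by have := bound x j xS; have := bound y j yS; lra.
have [m mE] := mid x y ltac:(by rewrite exy).
have : sublevel (Num.max (r / 2) (r - lambda * kappa / 2)) m.
  move=> i; rewrite le_max; apply/orP.
  pose a := Num.max (mdist x (pt i)) (mdist y (pt i)).
  have aA : a <= A by rewrite ge_max !bound.
  have mi : mdist m (pt i) <= a - kappa.
    by apply: mE; rewrite // le_max lexx ?orbT.
  have [ui|ui] := leP (u i) lambda.
    left; rewrite -lambdaA; apply: ler_pM => //; first exact: mdist_ge0.
    by lra.
  right; apply: le_trans (ler_wpM2l (u0 i) mi) _.
  have uia : u i * a <= r + eta.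
    by rewrite /a; case: (leP (mdist x _)) => _; [exact: (yS i)|exact: (xS i)].
  nra.
move=> mS; have := rmin _ (ex_intro _ m mS); rewrite le_max => /orP[]; first lra.
have := mulr_gt0 lambda0 kappa0; lra.
Qed.

End WeightedRadius.

(** The sublevel sets above level r generate a Cauchy filter; its limit lies in the
sublevel set at r because the weights are bounded. *)
Lemma sublevels_inter1 {R : realType} {X : completeMetricType R} {I : Type}
    (pt : I -> X) (u : I -> R) (M r : R) :
  (forall i, 0 <= u i <= M) ->
  (forall e, 0 < e -> sublevel pt u (r + e) !=set0) ->
  (forall e, 0 < e -> exists2 eta, 0 < eta & forall x y,
    sublevel pt u (r + eta) x -> sublevel pt u (r + eta) y -> mdist x y < e) ->
  exists! q, sublevel pt u r q.
Proof.
move=> uM ne shrink.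
have mono c c' : c <= c' -> sublevel pt u c `<=` sublevel pt u c'.
  by move=> cc' x xc i; exact: le_trans (xc i) cc'.
pose F := filter_from [set e : R | 0 < e] (fun e => sublevel pt u (r + e)).
have PF : ProperFilter F.
  apply: filter_from_proper; last by move=> e /ne.
  apply: filter_from_filter; first by exists 1 => /=.
  move=> e1 e2 /= e10 e20; exists (Num.min e1 e2); first by rewrite /= lt_min e10.
  by move=> x xS; split; apply: mono xS; rewrite lerD2l ge_min lexx ?orbT.
have : cauchy F.
  apply: cauchy_exP => e e0; have [eta eta0 shr] := shrink e e0.
  have [x xS] := ne eta eta0; exists x, eta => // y yS.
  by rewrite ballEmdist /=; exact: shr.
move=> /cauchy_cvg /cvg_ex[/= q /metricType_numDomainType.fcvgrPdist_lt Fq].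
have qS : sublevel pt u r q.
  move=> i; apply/ler_addgt0Pr => e e0.
  have /andP[ui0 uiM] := uM i.
  have M10 : 0 < M + 1 by lra.
  pose d := e / (2 * (M + 1)).
  have d0 : 0 < d by rewrite divr_gt0 ?mulr_gt0.
  have Md : (M + 1) * d = e / 2 by rewrite /d; field; rewrite gt_eqF.
  have [eta eta0 etaS] := Fq d d0.
  have [|x xS] := ne (Num.min eta (e / 2)); first by rewrite lt_min eta0 divr_gt0.
  have xi : u i * mdist x (pt i) <= r + e / 2.
    by rewrite (le_trans (xS i)) // lerD2l ge_min lexx orbT.
  have qx : mdist q x < d.
    by apply: etaS; apply: mono xS; rewrite lerD2l ge_min lexx.
  have := metric_triangle q x (pt i); have := mdist_ge0 q x; nra.
exists q; split=> // q' q'S; apply: mdist_positivity.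
apply/eqP; rewrite eq_le mdist_ge0 andbT; apply/ler_addgt0Pl => e e0; rewrite addr0.
have [eta eta0 shr] := shrink e e0.
by apply/ltW/shr; [move: qS|move: q'S]; apply: mono; rewrite lerDl ltW.
Qed.

(** The room between 2 delta and D_k/2 is what allows almost optimal points,
and not just optimal ones, to be within A of P. *)
Lemma small_diameter_bounds {R : realType} (k : R) (X : metricType R)
    (P : set X) : P !=set0 ->
  (diameter (@mdist R X) P < model_diam k * (4^-1)%:E)%E ->
  exists delta A : R, [/\ forall p q, P p -> P q -> mdist p q <= delta,
    0 <= delta, 2 * delta < A & ((2 * A)%:E < model_diam k)%E].
Proof.
move=> [p0 Pp0]; have diam_ub p q : P p -> P q ->
    ((mdist p q)%:E <= diameter (@mdist R X) P)%E.
  by move=> Pp Pq; apply: ereal_sup_ubound; exists p => //; exists q.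
have := diam_ub p0 p0 Pp0 Pp0; rewrite mdistxx.
case: (diameter _ _) diam_ub => [delta||//] diam_ub; last first.
  by move=> _; rewrite ltNge leey.
rewrite lee_fin => delta0 small; exists delta.
have {}diam_ub p q : P p -> P q -> mdist p q <= delta.
  by move=> Pp Pq; rewrite -lee_fin diam_ub.
move: small; rewrite /model_diam; case: ifP => [_|_ _].
  move: (pi / _) => D; rewrite -EFinM lte_fin => small; exists (delta + D / 4).
  by split=> //; rewrite ?lte_fin; lra.
by exists (2 * delta + 1); split; rewrite ?ltry //; lra.
Qed.

(** An index l whose weight is close to the supremum M of the weights satisfies
M delta < u(l) (A - delta), while the infimum r is at most M delta, which bounds
the weighted radius at each of the points.  So an almost optimal point is within A - delta of pt l. *)
Lemma sublevel_near {R : realType} {X : metricType R} {I : Type}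
    (pt : I -> X) (u : I -> R) (delta A r : R) :
  (forall i j, mdist (pt i) (pt j) <= delta) -> 2 * delta < A ->
  (forall i, 0 <= u i) -> (exists M, forall i, u i <= M) ->
  (exists i, 0 < u i) ->
  (forall c, sublevel pt u c !=set0 -> r <= c) ->
  exists2 e0, 0 < e0 &
    sublevel pt u (r + e0) `<=` [set x | forall i, mdist x (pt i) <= A].
Proof.
move=> ptd dA u0 [M0 uM0] [j uj] rmin.
have delta0 : 0 <= delta by apply: le_trans (ptd j j); exact: mdist_ge0.
pose M := sup (range u).
have supu : has_sup (range u) by split; [exists (u j), j|exists M0 => _ [i _ <-]].
have uM i : u i <= M by apply: sup_upper_bound => //; exists i.
have M_gt0 : 0 < M by exact: lt_le_trans (uM j).
have rM : r <= M * delta.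
  apply: rmin; exists (pt j) => i; apply: ler_pM => //; exact: mdist_ge0.
have Ad : delta < A - delta by lra.
have [_ [l _ <-] lM] : exists2 v, range u v & M * delta / (A - delta) < v.
  apply: sup_gt; first by case: supu.
  by rewrite ltr_pdivrMr ?ltr_pM2l //; lra.
have ul : M * delta < u l * (A - delta) by rewrite -ltr_pdivrMr //; lra.
exists (u l * (A - delta) - M * delta); first by rewrite subr_gt0.
move=> x xS i; have ul0 : 0 < u l by move: (u0 l); nra.
have xl : mdist x (pt l) <= A - delta.
  by rewrite -(ler_pM2l ul0) (le_trans (xS l)) //; lra.
have := metric_triangle x (pt l) (pt i); have := ptd l i; lra.
Qed.

(** * The weighted centre *)

Theorem theorem1 (R : realType) (k : R) (X : completeMetricType R)
    (P : set X) (u : P -> R) :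
  CAT k X ->
  (diameter (@mdist R X) P < model_diam k * (4^-1)%:E)%E ->
  (exists M, forall p, `|u p| <= M) ->
  (forall p, 0 <= u p) ->
  (exists p, u p != 0) ->
  exists! q : X,
    ereal_sup (range (fun p : P => (u p * mdist q (val p))%:E)) =
    ereal_inf (range (fun x : X =>
      ereal_sup (range (fun p : P => (u p * mdist x (val p))%:E)))).
Proof.
move=> cat small [M uM'] u0 [j uj].
have uM i : u i <= M by apply: le_trans (uM' i); exact: ler_norm.
have {}uj : 0 < u j by rewrite lt_neqAle eq_sym uj u0.
have [|delta [A [Pdelta delta0 dA Ak]]] := small_diameter_bounds _ small.
  by exists (val j); exact: set_valP.
have ptd (p q : P) : mdist (val p) (val q) <= delta.
  by apply: Pdelta; exact: set_valP.
have A0 : 0 < A by lra.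
pose f x := ereal_sup (range (fun p : P => (u p * mdist x (val p))%:E)).
rewrite -/(f _); set r' := ereal_inf _.
have f_le x c : (f x <= c%:E)%E <-> sublevel (fun p : P => val p) u c x.
  split=> [/ereal_supP fx p|xc].
    by rewrite -lee_fin; apply: fx; exists p.
  by apply/ereal_supP => _ [p _ <-]; rewrite lee_fin.
have r'f x : (r' <= f x)%E by apply: ereal_inf_lbound; exists x.
have r'0 : (0 <= r')%E.
  apply/ereal_infP => _ [x _ <-].
  apply: le_trans (ereal_sup_ubound _); last by exists j.
  by rewrite lee_fin mulr_ge0 ?mdist_ge0.
have : (r' <= (M * delta)%:E)%E.
  apply: le_trans (r'f (val j)) _; apply/f_le => p.
  by apply: ler_pM => //; exact: mdist_ge0.
have r'inf : r' = ereal_inf (range f) by [].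
case: r' r'f r'0 r'inf => [r||//] r'f; last by rewrite leye_eq.
rewrite lee_fin => r0 rinf _.
have fE x : f x = r%:E <-> sublevel (fun p : P => val p) u r x.
  rewrite -f_le; split=> [->//|fx]; apply/eqP.
  by rewrite eq_le fx r'f.
have rmin c : sublevel (fun p : P => val p) u c !=set0 -> r <= c.
  by move=> [x /f_le fx]; rewrite -lee_fin (le_trans (r'f x)).
have ne e : 0 < e -> sublevel (fun p : P => val p) u (r + e) !=set0.
  move=> e0; have : (ereal_inf (range f) < (r + e)%:E)%E.
    by rewrite -rinf lte_fin ltrDl.
  by move=> /ereal_inf_lt[_ [x _ <-] /ltW /f_le xe]; exists x.
have [e0 e0_gt0 near_pt] :=
  sublevel_near ptd dA u0 (ex_intro _ M uM) (ex_intro _ j uj) rmin.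
have shrink := sublevels_shrink u0 (ex_intro _ j uj) A0 r0 rmin e0_gt0 near_pt
  (CAT_uniform_midpoints cat A0 Ak).
have uM2 i : 0 <= u i <= M by rewrite u0 uM.
have [q [qS quniq]] := sublevels_inter1 uM2 ne shrink.
by exists q; split=> [|q' /fE]; [exact/fE|exact: quniq].
Qed.
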